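(* Let $G=(V,E)$ be a split graph, let $u\notin V$, and let $r=\omega(G)$. Then the algorithm ACCN, with primary instance $G$ and secondary instance $G\vee u$, returns $c^*(G\vee u)=r+1$.
   Context: All graphs are finite (with non-empty vertex set), simple, undirected and loop-free. A split graph is a graph whose vertex set can be partitioned into a clique and an independent set. $\omega(H)$ is the clique number of $H$, i.e. the largest size of a set of pairwise adjacent vertices. For $u\notin V$, $G\vee u$ is the graph with vertex set $W=V\cup\{u\}$ whose edges are the edges of $G$ together with all $\{u,x\}$, $x\in V$. In $G\vee u$, $C(x)=N(x)\cup\{x\}$ is the closed neighbourhood of $x$. For $A\subset W$ and $z\in A$, $d_z(A)$ is the degree of $z$ in the subgraph of $G\vee u$ induced by $A$. Algorithm ACCN. Input: the vertex set and the adjacency matrix of the primary instance $G$. Phase 1: construct the vertex set and the adjacency matrix of the secondary instance $G\vee u$. Phase 2: for each $y\in W$: put $A=C(y)$; for each $z\in A$ compute $d_z(A)$; compute the largest $k$ such that there are at least $k$ vertices $z\in A$ with $d_z(A)\ge k$; set $c(y{:}u)=k+1$. Phase 3: for each $y\in W$ set $c^*(y{:}u)=c(y{:}u)$. Then, for each $y\in W$ with $y\ne u$: compute the largest $p$ such that there are at least $p$ vertices $z\in C(y)$, including $y$ and $u$ (i.e. $y$ and $u$ are among these vertices), such that $p\le c^*(z{:}u)$; set $c^*(y{:}u)=p$. Finally compute the largest $p$ such that there are at least $p$ vertices $z\in W$, including $u$, such that $p\le c^*(z{:}u)$; set $c^*(u{:}u)=p$ and $c^*(G\vee u)=c^*(u{:}u)$.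 Return $c^*(G\vee u)$. *)

(* Defs.v *)
From mathcomp Require Import all_boot.

Set Implicit Arguments.
Unset Strict Implicit.
Unset Printing Implicit Defensive.

(* The largest k <= n such that P k. *)
Definition largest (n : nat) (P : pred nat) : nat := \max_(k < n.+1 | P k) k.

(* In every use of [largest] below, P 0 holds and P k forces k <= n, so that
   the bound n plays no role. *)
Lemma largestP (n : nat) (P : pred nat) :
    P 0 -> (forall k, P k -> k <= n) ->
  P (largest n P) /\ (forall k, P k -> k <= largest n P).
Proof.
move=> P0 Pn; split; last first.
  move=> k Pk; have ltkn : k < n.+1 by rewrite ltnS Pn.
  exact: (@bigmax_sup _ (Ordinal ltkn) (fun i => P i) k (fun i => val i)).
rewrite /largest; apply: (big_ind (fun k : nat => P k)) => // a b Pa Pb.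
by rewrite /maxn; case: ifP.
Qed.

Section Graphs.

Variables (V : finType) (e : rel V).

Definition simple_graph : Prop := symmetric e /\ irreflexive e.

Definition clique (K : {set V}) : bool :=
  [forall x in K, forall y in K, (x != y) ==> e x y].

Definition independent (I : {set V}) : bool :=
  [forall x in I, forall y in I, ~~ e x y].

Definition split_graph : Prop :=
  exists K : {set V}, clique K /\ independent (~: K).

Definition clique_number : nat := \max_(K : {set V} | clique K) #|K|.

Definition closed_nbhd (x : V) : {set V} := [set y | (y == x) || e x y].

Definition induced_degree (A : {set V}) (z : V) : nat :=
  #|[set x in A | e z x]|.

(* G \/ u on the vertex set W = option V: the new vertex u is None. *)
Definition join_rel : rel (option V) := fun a b =>
  match a, b with
  | Some x, Some y => e x y
  | None, None => false
  | _, _ => true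
  end.

End Graphs.

Section Phases.

Variables (W : finType) (e : rel W) (u : W).

Definition phase2 : {ffun W -> nat} :=
  [ffun y => let A := closed_nbhd e y in
    (largest #|A| (fun k => k <= #|[set z in A | k <= induced_degree e A z]|)).+1].

(* There are at least p vertices z in A, those of B being among them, such that
   p <= c z. *)
Definition enough (c : {ffun W -> nat}) (A B : {set W}) (p : nat) : bool :=
  [exists S : {set W}, [&& S \subset A, B \subset S, p <= #|S|
                         & [forall z in S, p <= c z]]].

(* One assignment c*(y:u) := p, computed from the current values of c*. *)
Definition phase3_step (c : {ffun W -> nat}) (y : W) : {ffun W -> nat} :=
  let A := closed_nbhd e y in
  let p := largest #|A| (enough c A [set y; u]) in
  [ffun z => if z == y then p else c z].

(* The assignments are made in place, in the order given by s. *)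
Definition phase3_loop (c : {ffun W -> nat}) (s : seq W) : {ffun W -> nat} :=
  foldl phase3_step c s.

Definition phase3 (c : {ffun W -> nat}) (s : seq W) : nat :=
  largest #|W| (enough (phase3_loop c s) [set: W] [set u]).

End Phases.

(* s is the order in which the vertices other than u are visited in Phase 3. *)
Definition ACCN (V : finType) (e : rel V) (s : seq (option V)) : nat :=
  phase3 (join_rel e) None (phase2 (join_rel e)) s.

(* Main.v *)
Require Import Defs.
From mathcomp Require Import all_boot.

Set Implicit Arguments.
Unset Strict Implicit.

(** Write [r] for the clique number of [G].  Two bounds on the value returned,
    valid for any graph with a distinguished vertex [u], meet at [r + 1].

    From below: if [Q] is a clique containing [u], then [Q] itself is a witness
    for the value [#|Q|] in every maximization centred at a vertex of [Q].  So
    no value on [Q] ever drops below [#|Q|] ([clique_leq_phase3]).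

    From above: let [K] be a set of vertices such that every vertex outside [K]
    has at most [#|K|] closed neighbours.  Phase 2 gives these outer vertices
    values at most [#|K|], and an update never raises a value that is at most
    [#|K|], because the updated vertex is itself among the vertices counted.
    Hence only vertices of [K] can ever have a value above [#|K|], and there are
    too few of them to make the final maximum exceed [#|K|]
    ([phase3_leq_card]).

    In a split graph, the clique part of the partition can be taken to be a
    maximum clique [K] ([split_graph_max_clique]).  A vertex outside [K] then has
    all its neighbours in [K], but not the whole of [K], as it would otherwise
    extend [K]; it thus has at most [r] closed neighbours in [G], and [r + 1] in
    the join.  So [K] together with [u], of size [r + 1], meets the requirements
    of both bounds. *)

(** * Maximization *)

Lemma leq_largest (n : nat) (P : pred nat) (k : nat) :
  k <= n -> P k -> k <= largest n P.
Proof.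
move=> lekn Pk; have ltkn : k < n.+1 by rewrite ltnS.
exact: (@bigmax_sup _ (Ordinal ltkn) (fun i => P i) k (fun i => val i)).
Qed.

Lemma largest_leq (n : nat) (P : pred nat) (m : nat) :
  (forall k, P k -> k <= m) -> largest n P <= m.
Proof. by move=> Pm; apply/bigmax_leqP => i; apply: Pm. Qed.

(** * Cliques and degrees *)

Section Graph.

Variables (W : finType) (e : rel W).

Lemma cliqueP (K : {set W}) :
  reflect {in K &, forall x y, x != y -> e x y} (clique e K).
Proof.
apply: (iffP 'forall_in_forall_inP) => h x.
  by move=> y Kx Ky; apply/implyP; apply: h.
by move=> Kx y Ky; apply/implyP; apply: h.
Qed.

Lemma independentP (I : {set W}) :
  reflect {in I &, forall x y, ~~ e x y} (independent e I).
Proof. by apply: (iffP 'forall_in_forall_inP) => h x; [move=> y|] => *; apply: h. Qed.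

Lemma clique_sub_nbhd (Q : {set W}) (y : W) :
  clique e Q -> y \in Q -> Q \subset closed_nbhd e y.
Proof.
move=> /cliqueP clQ Qy; apply/subsetP => x Qx; rewrite inE.
by case: eqVneq => //= neq_xy; apply: clQ; rewrite // eq_sym.
Qed.

Lemma clique_degree (Q A : {set W}) (z : W) :
  clique e Q -> Q \subset A -> z \in Q -> #|Q| <= (induced_degree e A z).+1.
Proof.
move=> /cliqueP clQ /subsetP sQA Qz; rewrite (cardsD1 z) Qz ltnS.
apply/subset_leq_card/subsetP => x; rewrite !inE => /andP[neq_xz Qx].
by rewrite sQA //= clQ // eq_sym.
Qed.

Lemma induced_degree_lt (A : {set W}) (z : W) :
  irreflexive e -> z \in A -> induced_degree e A z < #|A|.
Proof.
move=> irr Az; rewrite (cardsD1 z A) Az ltnS; apply/subset_leq_card/subsetP => x.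
rewrite !inE => /andP[-> ezx]; rewrite andbT.
by apply: contraTneq ezx => ->; rewrite irr.
Qed.

Lemma clique_independent_card (Q I : {set W}) :
  clique e Q -> independent e I -> #|Q :&: I| <= 1.
Proof.
move=> /cliqueP clQ /independentP indI.
apply/card_le1P => x; rewrite inE => /andP[Qx Ix] y.
rewrite !inE; apply/idP/eqP => [/andP[Qy Iy]|->]; last by rewrite Qx Ix.
by apply: contraNeq (indI _ _ Ix Iy) => neq_yx; rewrite clQ // eq_sym.
Qed.

Lemma clique_card_leq (K : {set W}) : clique e K -> #|K| <= clique_number e.
Proof. by move=> clK; rewrite /clique_number (bigmax_sup K). Qed.

Lemma ex_max_clique : exists2 M, clique e M & #|M| = clique_number e.
Proof.
have cl0 : clique e set0 by apply/cliqueP => x y; rewrite inE.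
have : 0 < #|[pred K | clique e K]| by apply/card_gt0P; exists set0.
by case/(eq_bigmax_cond (fun K : {set W} => #|K|)) => M clM eqM; exists M.
Qed.

(** A maximum clique [M] has at most one vertex outside the clique part [K] of a
    split partition.  So if [K] is smaller than [M], then [M] contains [K], and
    [M] can replace [K] in the partition. *)
Lemma split_graph_max_clique : split_graph e ->
  exists K, [/\ clique e K, independent e (~: K) & #|K| = clique_number e].
Proof.
case=> K [clK indK]; have [M clM cardM] := ex_max_clique.
have := clique_card_leq clK; rewrite leq_eqVlt => /predU1P[|ltKM].
  by exists K.
have sKM : K \subset M.
  apply/setIidPr/eqP; rewrite eqEcard subsetIr /= -ltnS.
  apply: leq_trans ltKM _; rewrite -cardM -(cardsID K M) -addn1 leq_add2l.
  by rewrite setDE clique_independent_card.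
exists M; split=> //; move: sKM; rewrite -setCS => /subsetP sMK.
by apply/independentP => x y Mx My; apply: (independentP _ indK); apply: sMK.
Qed.

(** The neighbours of [x] all lie in [K], but they are not all of [K], by
    maximality; this leaves room to count [x] itself. *)
Lemma max_clique_nbhd_card (K : {set W}) (x : W) :
  simple_graph e -> clique e K -> independent e (~: K) ->
  #|K| = clique_number e -> x \notin K -> #|closed_nbhd e x| <= #|K|.
Proof.
move=> [sym irr] clK /independentP indK maxK nKx.
have defN : closed_nbhd e x = x |: [set y | e x y] by apply/setP => y; rewrite !inE.
rewrite defN cardsU1 inE irr; apply: proper_card; rewrite properE.
have sNK : [set y | e x y] \subset K.
  apply/subsetP => y; rewrite inE; apply: contraTT => nKy.
  by apply: indK; rewrite inE.
rewrite sNK; apply/negP => /subsetP sKN.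
have adjK y : y \in K -> e x y by move=> /sKN; rewrite inE.
suff /clique_card_leq : clique e (x |: K) by rewrite cardsU1 nKx -maxK ltnn.
apply/cliqueP => y z; rewrite !inE => /predU1P[->|Ky] /predU1P[->|Kz].
- by rewrite eqxx.
- by rewrite adjK.
- by rewrite sym adjK.
- exact: (cliqueP _ clK).
Qed.

(** * Bounds on the two phases *)

Lemma clique_leq_phase2 (Q : {set W}) (y : W) :
  clique e Q -> y \in Q -> #|Q| <= phase2 e y.
Proof.
move=> clQ Qy; rewrite ffunE /=; have sQA := clique_sub_nbhd clQ Qy.
have defQ : #|Q|.-1.+1 = #|Q| by rewrite prednK //; apply/card_gt0P; exists y.
rewrite -defQ ltnS; apply: leq_largest.
  by apply: leq_trans (leq_pred _) (subset_leq_card sQA).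
apply: leq_trans (leq_pred _) _; apply/subset_leq_card/subsetP => z Qz.
by rewrite inE (subsetP sQA) //= -ltnS defQ clique_degree.
Qed.

(** In a loopless graph all degrees in the subgraph induced by [A] are below
    [#|A|], so a positive number of vertices of degree at least [k] forces
    [k < #|A|]; this makes up for the successor taken at the end of Phase 2. *)
Lemma phase2_leq_nbhd (y : W) :
  irreflexive e -> phase2 e y <= #|closed_nbhd e y|.
Proof.
move=> irr; rewrite ffunE /=; set A := closed_nbhd e y.
have Ay : y \in A by rewrite inE eqxx.
have A_gt0 : 0 < #|A| by apply/card_gt0P; exists y.
rewrite -(prednK A_gt0) ltnS; apply: largest_leq => -[//|k] lek.
have /card_gt0P[z] := leq_trans (ltn0Sn k) lek.
rewrite inE => /andP[Az ltk]; rewrite -ltnS prednK //.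
exact: leq_ltn_trans ltk (induced_degree_lt irr Az).
Qed.

Lemma clique_enough (c : {ffun W -> nat}) (A B Q : {set W}) :
    Q \subset A -> B \subset Q -> {in Q, forall z, #|Q| <= c z} ->
  enough c A B #|Q|.
Proof.
move=> sQA sBQ leQ; apply/existsP; exists Q; rewrite sQA sBQ leqnn /=.
exact/forall_inP.
Qed.

(** If all the vertices counted lie in [K], then there are at most [#|K|] of them;
    otherwise one of them lies outside [K], and its value bounds [p]. *)
Lemma enough_card (c : {ffun W -> nat}) (A B K : {set W}) (p : nat) :
  {in ~: K, forall z, c z <= #|K|} -> enough c A B p -> p <= #|K|.
Proof.
move=> leK /existsP[S /and4P[_ _ lepS /forall_inP lepc]].
have [/subset_leq_card|/subsetPn[z Sz nKz]] := boolP (S \subset K).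
  exact: leq_trans.
by apply: leq_trans (lepc z Sz) (leK z _); rewrite inE.
Qed.

Lemma phase3_loop_ind (P : {ffun W -> nat} -> Prop) (u : W) (s : seq W) :
    (forall c y, P c -> P (phase3_step e u c y)) ->
  forall c, P c -> P (phase3_loop e u c s).
Proof. by move=> Pstep; elim: s => //= y s IHs c /Pstep/IHs. Qed.

(** The lower bound holds for any order of the updates: each of them preserves
    the inequality [#|Q| <= c z] on the whole of [Q]. *)
Lemma clique_leq_phase3 (u : W) (Q : {set W}) (s : seq W) :
  clique e Q -> u \in Q -> #|Q| <= phase3 e u (phase2 e) s.
Proof.
move=> clQ Qu; apply: leq_largest; first exact: max_card.
apply: clique_enough; rewrite ?subsetT ?sub1set //.
apply: (phase3_loop_ind (P := fun c => {in Q, forall z, #|Q| <= c z})); last first.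
  by move=> z; apply: clique_leq_phase2.
move=> c y leQ z Qz; rewrite ffunE; case: eqP => [eq_zy|_]; last exact: leQ.
have sQA := clique_sub_nbhd clQ Qz; rewrite -eq_zy.
apply: leq_largest; first exact: subset_leq_card.
by apply: clique_enough => //; rewrite subUset !sub1set Qz.
Qed.

(** The hypothesis on [K] serves only to bound the values given by Phase 2; every
    later maximization, including the last one, is handled by [enough_card]. *)
Lemma phase3_leq_card (u : W) (K : {set W}) (s : seq W) :
    irreflexive e -> {in ~: K, forall z, #|closed_nbhd e z| <= #|K|} ->
  phase3 e u (phase2 e) s <= #|K|.
Proof.
move=> irr leK; apply: largest_leq => p; apply: enough_card.
apply: (phase3_loop_ind (P := fun c => {in ~: K, forall z, c z <= #|K|})).
  move=> c y lecK z nKz; rewrite ffunE; case: eqP => [_|_]; last exact: lecK.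
  by apply: largest_leq => q; apply: enough_card.
by move=> z nKz; apply: leq_trans (phase2_leq_nbhd z irr) (leK z nKz).
Qed.

End Graph.

(** * The join with a new vertex *)

Section Join.

Variables (V : finType) (e : rel V).

Definition cone (A : {set V}) : {set option V} := None |: Some @: A.

Lemma mem_cone (A : {set V}) (x : V) : (Some x \in cone A) = (x \in A).
Proof. by rewrite !inE /= mem_imset //; apply: Some_inj. Qed.

Lemma None_cone (A : {set V}) : None \in cone A.
Proof. exact: setU11. Qed.

Lemma card_cone (A : {set V}) : #|cone A| = #|A|.+1.
Proof.
rewrite cardsU1 card_imset; last exact: Some_inj.
by case: imsetP => // -[].
Qed.

Lemma clique_cone (K : {set V}) : clique e K -> clique (join_rel e) (cone K).
Proof.
move=> /cliqueP clK; apply/cliqueP => -[x|] [y|] //.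
by rewrite !mem_cone; apply: clK.
Qed.

Lemma closed_nbhd_join (x : V) :
  closed_nbhd (join_rel e) (Some x) = cone (closed_nbhd e x).
Proof. by apply/setP => -[y|]; rewrite ?mem_cone ?None_cone !inE. Qed.

End Join.

Theorem proposition5p2 (V : finType) (e : rel V) (r : nat)
    (s : seq (option V)) :
  0 < #|V| ->
  simple_graph e ->
  split_graph e ->
  r = clique_number e ->
  perm_eq s (enum (predC1 (None : option V))) ->
  ACCN e s = r + 1.
Proof.
move=> _ simple_e split_e -> _.
have [K [clK indK maxK]] := split_graph_max_clique split_e.
rewrite -maxK addn1 -card_cone; apply/eqP; rewrite eqn_leq.
apply/andP; split; last first.
  by apply: clique_leq_phase3; [apply: clique_cone | apply: None_cone].
apply: phase3_leq_card => [[x|] //=|[x|]]; first by case: simple_e.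
  rewrite inE mem_cone closed_nbhd_join !card_cone => nKx.
  exact: max_clique_nbhd_card.
by rewrite inE None_cone.
Qed.
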